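(* Let $\mu,l,m\geq 1$, $s\geq 0$ and $1\leq\rho\leq\mu$ be integers with $\gcd(m,\mu+1)=1$. Let $$\lambda=\Lambda(\mu,s,l,\rho,m)=\left((m(s+l+1))^{\rho},(m(s+l))^{\mu},(m(s+l-1))^{\mu},\ldots,(m(s+1))^{\mu}\right),$$ $N=(s+l+1)\mu+s+\rho$, and for $0\leq k\leq l-1$ let $\lambda^{(k)}=\lambda-\varepsilon(\rho+k\mu)$. Then there exists a unique $\beta\in\mathbb{N}_0^{M}$, where $M=\ell(\lambda^{(k)})+|\lambda^{(k)}|$, such that $(\lambda^{(k)},\beta)$ is $\left(-\frac{m}{\mu+1}\right)$-critical, and this $\beta$ satisfies $\ell(\beta)=N+l-k>N$.
   Context: Exponents in partitions denote multiplicities; a partition is viewed as an element of $\mathbb{N}_0^M$ by appending zeros. $\varepsilon(i)$ is the $i$-th standard basis vector. For $\alpha\in\mathbb{N}_0^M$: $|\alpha|=\sum\alpha_i$, $\ell(\alpha)=\max\{j:\alpha_j>0\}$, and $\alpha^+$ is the nonincreasing rearrangement of $\alpha$. $\alpha\succ\beta$ means $\alpha\neq\beta$ and $\sum_{i=1}^j\alpha_i\geq\sum_{i=1}^j\beta_i$ for $1\leq j\leq M$; $\alpha\vartriangleright\beta$ means $|\alpha|=|\beta|$ and either $\alpha^+\succ\beta^+$, or $\alpha^+=\beta^+$ and $\alpha\succ\beta$. The rank function is $r(\alpha,i)=\#\{j:\alpha_j>\alpha_i\}+\#\{j:1\leq j\leq i,\alpha_j=\alpha_i\}$. Critical pairs: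 let $\alpha,\beta\in\mathbb{N}_0^M$ with $\alpha\vartriangleright\beta$, and let $m,n$ be positive integers with $\gcd(m,n)=1$. $(\alpha,\beta)$ is a $\left(-\frac mn\right)$-critical pair if $n\kappa+m$ divides $(r(\beta,i)-r(\alpha,i))\kappa+\alpha_i-\beta_i$ in $\mathbb{Q}[\kappa]$ for $1\leq i\leq M$ ($\kappa$ an indeterminate). *)

(* Defs.v *)
From mathcomp Require Import all_boot all_order all_algebra.

Set Implicit Arguments.
Unset Strict Implicit.
Unset Printing Implicit Defensive.

Import GRing.Theory.

(* MathComp world. An element of N_0^M is an [M.-tuple nat], with coordinates
   numbered 0, ..., M-1; a partition is a [seq nat], turned into such a tuple
   by [pad]. *)

Definition weight (a : seq nat) : nat := sumn a.

(* The value is 0 when all entries of [a] are 0. *)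
Definition len (a : seq nat) : nat := \max_(i < size a | 0 < nth 0 a i) i.+1.

Definition pad (M : nat) (a : seq nat) : M.-tuple nat := [tuple nth 0 a i | i < M].

Definition rearr (M : nat) (a : M.-tuple nat) : M.-tuple nat :=
  [tuple of sort geq a].

Definition succ_dom (M : nat) (a b : M.-tuple nat) : Prop :=
  a <> b /\
  forall j : 'I_M,
    \sum_(i < M | i <= j) tnth b i <= \sum_(i < M | i <= j) tnth a i.

Definition tri_dom (M : nat) (a b : M.-tuple nat) : Prop :=
  weight a = weight b /\
  (succ_dom (rearr a) (rearr b) \/ (rearr a = rearr b /\ succ_dom a b)).

Definition rank_fun (M : nat) (a : M.-tuple nat) (i : 'I_M) : nat :=
  #|[set j : 'I_M | tnth a i < tnth a j]|
  + #|[set j : 'I_M | (j <= i) && (tnth a j == tnth a i)]|.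

(* [critical_pair m n a b]: the pair (a, b) is (-m/n)-critical. The
   indeterminate kappa is 'X. *)
Definition critical_pair (m n M : nat) (a b : M.-tuple nat) : Prop :=
  [/\ 0 < m, 0 < n, coprime m n, tri_dom a b &
    forall i : 'I_M,
      ((n%:R *: 'X + m%:R%:P : {poly rat}) %|
        ((rank_fun b i)%:R - (rank_fun a i)%:R) *: 'X
        + ((tnth a i)%:R - (tnth b i)%:R)%:P)%R].

Definition Lambda (mu s l rho m : nat) : seq nat :=
  nseq rho (m * (s + l + 1))
  ++ flatten [seq nseq mu (m * (s + l - i)) | i <- iota 0 l].

(* [a] minus the standard basis vector epsilon(i), where i is counted from 1.
   The subtraction is truncated, so this is the true difference only when the
   i-th entry of [a] is positive. *)
Definition sub_eps (a : seq nat) (i : nat) : seq nat :=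
  mkseq (fun j => nth 0 a j - (j.+1 == i)) (size a).

(* Main.v *)
Require Import Defs.
From mathcomp Require Import all_boot all_order all_algebra.
From mathcomp Require Import perm zify ring.
Import GRing.Theory Num.Theory.

(* Let [n = mu + 1], count positions and ranks from 0, and let [P] be the position
   at which lambda is decreased, so that lambda^(k)_i = m a_i - [i = P].
   Divisibility by [n kappa + m] says that [m r(beta, i) + n beta_i] equals
   [m r(alpha, i) + n alpha_i]. As gcd(m, n) = 1, [beta_i + [i = P]] is a multiple
   [m b_i], and the rank permutation [w] of beta satisfies
   [n b_i + w_i = n a_i + i =: v_i].
   Inside the support of [a] the values [v] increase by at most [n - 2] from left to
   right, whereas an index [z > i] ranked just before [i] needs [b_z >= b_i + 1] and
   thus [v_z >= v_i + n - 1]. So [w] is the identity up to [P]. At [P] the rounding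
   allows [b_z = b_P], which leaves two cases: [w] is the identity everywhere and
   beta = lambda^(k), or the predecessor of [P] is the position
   [Y = P + mu + n (a_P - 1)], and then the block [P, ..., P + mu] is moved rigidly to
   the ranks ending at [Y], the positions [P + n, ..., Y] move down by [n], and all
   others are fixed. The second case does occur; the dominance condition follows
   because the partial sums of a difference that changes sign once and has total 0
   are nonnegative. *)

(** * Rank permutations solving the critical equation *)

(* The index ranked just before [i] would, if larger than [i], have a strictly
   larger [b], hence a larger [v] than the gap hypothesis allows; and positions [y] beyond
   the reach of [v i] are fixed by downward induction. *)
Lemma fixed_prefix (n lo hi P : nat) (w b v : nat -> nat) :
  0 < n ->
  (forall i, lo <= i < hi -> lo <= w i < hi) ->
  (forall i j, lo <= i < hi -> lo <= j < hi -> w i = w j -> i = j) ->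
  (forall r, lo <= r < hi -> exists2 i, lo <= i < hi & w i = r) ->
  (forall i, lo <= i < hi -> v i = n * b i + w i) ->
  (forall i j, lo <= i -> i <= j -> j < hi -> v j = j \/ v j + 2 <= v i + n) ->
  (forall i j, lo <= i -> i < j -> j < hi -> i < P -> w j < w i -> b i < b j) ->
  forall i, lo <= i < hi -> i < P -> w i = i.
Proof.
move=> n_gt0 w_bd w_inj w_surj vE v_bd w_ord; elim/ltn_ind => i IH i_in iP.
have tail e y : hi - y <= e -> i <= y < hi -> v i + n <= y.+1 -> w y = y.
  elim: e y => [|e IHe] y ye yi yv; first by lia.
  have [|x x_in wx] := w_surj y; first by lia.
  have vx := vE _ x_in.
  have [xi|ix] := ltnP x i; first by have := IH _ xi x_in; lia.
  have [||||] := v_bd i x; try lia.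
  move=> vxx; have [{1}->//|xy] := eqVneq y x.
  have yx : y <= x by rewrite -vxx vx wx leq_addl.
  have wxx : w x = x by apply: IHe; lia.
  by lia.
have [//|wi] := eqVneq (w i) i.
have wi_bd := w_bd _ i_in.
have lt_i_wi : i < w i.
  rewrite ltnNge; apply/negP => le_wi.
  have wwi : w (w i) = w i by apply: IH; lia.
  by have := w_inj _ _ wi_bd i_in wwi; lia.
have [|z z_in wz] := w_surj (w i).-1; first by lia.
have [zi|iz] := ltnP z i; first by have := IH _ zi z_in; lia.
have {}iz : i < z by rewrite ltn_neqAle iz andbT; apply/eqP => zi; subst z; lia.
have b_lt : b i < b z by apply: w_ord; lia.
have := vE _ z_in; have := vE _ i_in => vi vz.
have nb : n * (b i).+1 <= n * b z by rewrite leq_mul2l b_lt orbT.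
rewrite mulnS in nb.
have [||||] := v_bd i z; try lia.
move=> vzz; have wzz : w z = z by apply: (tail _ z (leqnn _)); lia.
by lia.
Qed.

(* [a] is the shape of the blocks of Lambda divided by [m], [P] the 0-based last
   position of the block whose entry gets decreased, and [mu.+1] is the
   denominator [n] of the critical value [- m / n]. *)
Record block_profile (mu P A : nat) (a : nat -> nat) : Prop := BlockProfile {
  profile_mu : 0 < mu;
  profile_A : 0 < A;
  profile_mono : forall i j, i <= j -> a j <= a i;
  profile_gap : forall i j, i <= j ->
    a j = 0 \/ mu.+1 * a j + j + 2 <= mu.+1 * a i + i + mu.+1;
  profile_corner : a P = A.+1;
  profile_plateau : forall i, P < i <= P + mu -> a i = A;
  profile_beyond : forall j, P + mu < j ->
    a j = 0 \/ mu.+1 * a j + j < P + mu + mu.+1 * A }.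

(* The rank permutation of the critical partner. *)
Definition block_shift (mu P A i : nat) : nat :=
  if i < P then i
  else if i <= P + mu then i + mu.+1 * A
  else if i <= P + mu + mu.+1 * A then i - mu.+1
  else i.

(* [w] is the 0-based rank function of a composition and [b] is that composition divided by [m]
   and rounded up; the rounding is proper only at [P], which is why the order
   hypotheses are weaker there. *)
Lemma rank_dichotomy (mu P A M : nat) (a w b : nat -> nat) :
  block_profile mu P A a ->
  P + mu + mu.+1 * A < M ->
  (forall i, i < M -> w i < M) ->
  (forall i j, i < M -> j < M -> w i = w j -> i = j) ->
  (forall r, r < M -> exists2 i, i < M & w i = r) ->
  (forall i, i < M -> mu.+1 * a i + i = mu.+1 * b i + w i) ->
  0 < b P ->
  (forall i j, i < j -> j < M -> i != P -> w j < w i -> b i < b j) ->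
  (forall j, P < j -> j < M -> w j < w P -> b P <= b j) ->
  (forall i j, i < j -> j < M -> j != P -> w i < w j -> b j <= b i) ->
  (forall i, i < M -> w i = i) \/ (forall i, i < M -> w i = block_shift mu P A i).
Proof.
case=> mu_gt0 A_gt0 a_mono a_gap aP aPt a_end ltYM w_bd w_inj w_surj wE bP_gt0.
move=> ord_inv ord_invP ord_noninv.
pose n := mu.+1; pose v i := n * a i + i.
have nE : n = mu.+1 by [].
rewrite -/n in ltYM wE a_gap a_end *.
set T := n * A in ltYM a_end *.
have vE i : i < M -> v i = n * b i + w i by exact: wE.
have vP : v P = P + T + n by rewrite /v aP mulnS /T; lia.
have vPt i : P < i <= P + mu -> v i = i + T by move=> /aPt; rewrite /v => ->; rewrite addnC.
have v_end j : P + mu < j -> v j = j \/ v j < P + mu + T.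
  by move=> /a_end []; [left; rewrite /v; nia | right].
have v_gap i j : i <= j -> v j = j \/ v j + 2 <= v i + n.
  by move=> /a_gap []; [left; rewrite /v; nia | right].
have ltPM : P < M by lia.
have vE' r i : i < M -> w i = r -> v i = n * b i + r by move=> /vE + <-.
have wP i : i < P -> w i = i.
  move=> iP; apply: (@fixed_prefix n 0 M P w b v) => //; last by lia.
    by move=> x y _ xy _; apply: v_gap.
  by move=> x y _ xy yM xP; apply: ord_inv => //; lia.
have wPinv i : i < M -> w i < P -> i < P.
  by move=> iM wiP; rewrite -(w_inj _ _ (w_bd _ iM) iM (wP _ wiP)).
(* If [P] keeps its rank, nothing after it is ranked before it, so the strict order hypothesis holds
   vacuously at [P]. *)
have [wPP|wPP] := eqVneq (w P) P.
  left=> i iM; apply: (@fixed_prefix n 0 M M w b v) => //.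
    by move=> x y _ xy _; apply: v_gap.
  move=> x y _ xy yM xM; have [xP|] := eqVneq x P; last by move/ord_inv; apply.
  by rewrite xP wPP => /(wPinv _ yM); lia.
have w_geP i : P <= i -> i < M -> P <= w i.
  by move=> Pi iM; rewrite leqNgt; apply/negP => /(wPinv _ iM); lia.
have {}wPP : P < w P by have := w_geP P (leqnn _) ltPM; lia.
(* [Y] will be the position ranked just before [P]; note [v P = Y + 1]. *)
have [Y YE] : exists Y, Y = P + mu + T by exists (P + mu + T).
have vlow i : P < i <= P + mu -> v i <= Y by move=> /[dup] /vPt ->; lia.
rewrite -YE in ltYM v_end *.
have tail y : Y < y < M -> w y = y.
  have [e] := ubnP (M - y); elim: e y => // e IHe y ye yY.
  have [|x xM wx] := w_surj y; first by lia.
  have vx := vE' _ _ xM wx.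
  have [xP|Px] := ltnP x P; first by have := wP _ xP; lia.
  have [xP|xP] := eqVneq x P.
    by move: vx; rewrite xP vP in bP_gt0 *; nia.
  have [xmu|mux] := leqP x (P + mu); first by have := vlow x; lia.
  have [vxx|] := v_end x mux; last by lia.
  have [{1}->//|xy] := eqVneq y x.
  by have wxx : w x = x by [apply: IHe; lia]; lia.
have b_tail y : Y < y < M -> v y = y -> b y = 0.
  by move=> yY vy; have := vE y; rewrite tail // vy; nia.
(* Modulo [n], [w i] is congruent to [v i], hence to [i], whereas [0 < i - P < n]. *)
have w_mod i : P < i <= P + mu -> i < M -> w i != P.
  move=> iP iM; apply/eqP => wi; have := vE' _ _ iM wi; rewrite vPt //.
  have -> : i + T = n * A + (i - P) + P by lia.
  by move/addIn => /(congr1 (modn^~ n)); rewrite mulnC modnMDl modnMr modn_small; lia.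
(* A predecessor [z > i] would have [v z > Y], hence [b z = 0], against [b i < b z]. One between [P]
   and [i] has [v z >= v i - 1], hence is [i - 1]. *)
have pred_Pt i : P < i <= P + mu -> exists2 z, (w z).+1 = w i & z = P \/ P < z /\ z.+1 = i.
  move=> iP; have iM : i < M by lia.
  have wi_gt : P < w i by have := w_mod _ iP iM; have := w_geP i; lia.
  have wi_lt := w_bd _ iM.
  have [|z zM wz] := w_surj (w i).-1; first by lia.
  exists z; first by lia.
  have [zP|Pz] := ltnP z P; first by have := wP _ zP; lia.
  have [|zP] := eqVneq z P; [by left | right].
  have vz := vE _ zM; have vi := vE _ iM; have vi' := vPt _ iP.
  have [iz|zi] := ltnP i z.
    have b_lt : b i < b z by apply: ord_inv => //; lia.
    have nb : n * b i + n <= n * b z by rewrite addnC -mulnS leq_mul2l b_lt orbT.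
    have [zmu|muz] := leqP z (P + mu); first by have := vlow z; lia.
    have [vzz|] := v_end z muz; last by lia.
    have := b_tail z; lia.
  have {}zi : z < i by rewrite ltn_neqAle zi andbT; apply/eqP => zi'; move: wz; rewrite zi'; lia.
  have b_le : b i <= b z by apply: ord_noninv => //; lia.
  have nb : n * b i <= n * b z by rewrite leq_mul2l b_le orbT.
  by have := vPt z; lia.
have wP_lt i : P < i <= P + mu -> w P < w i.
  elim/ltn_ind: i => i IHi iP.
  have [z wz [zP|[Pz zi]]] := pred_Pt _ iP; first by rewrite -wz zP.
  by rewrite -wz ltnS ltnW // IHi; lia.
right.
(* Plateau ranks exceed [w P], so the predecessor [x] of [P] lies past the plateau. Now [b P <= b x]
   gives [v x >= v P - 1 = Y], and [b x > 0] leaves only [x = Y]. *)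
have [wY bY] : (w Y).+1 = w P /\ 0 < b Y.
  have wP_M := w_bd _ ltPM.
  have [|x xM wx] := w_surj (w P).-1; first by lia.
  have Px : P < x.
    rewrite ltnNge leq_eqVlt; apply/negP => /orP[/eqP xP|xP].
      by rewrite xP in wx; lia.
    by have := wP _ xP; lia.
  have [xmu|mux] := leqP x (P + mu); first by have := wP_lt x; lia.
  have b_le : b P <= b x by apply: ord_invP => //; lia.
  have nb : n * b P <= n * b x by rewrite leq_mul2l b_le orbT.
  have vx := vE _ xM; have vP' := vE _ ltPM.
  have [vxx|] := v_end x mux; last by lia.
  have xY : x <= Y by rewrite leqNgt; apply/negP => xY; have := b_tail x; lia.
  by have -> : Y = x by [lia]; split; lia.
have w_top : w (P + mu) = Y.
  have [|i iM wi] := w_surj Y; first by lia.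
  have vi := vE' _ _ iM wi.
  have [iP|Pi] := ltnP i P; first by have := wP _ iP; lia.
  have [iP|iP] := eqVneq i P.
    by move: vi; rewrite iP vP; nia.
  have [imu|mui] := leqP i (P + mu).
    by have -> : P + mu = i by [have := vPt i; lia].
  have [vii|] := v_end i mui; last by lia.
  have [iY|iY] := eqVneq i Y; first by move: vi wi vii; rewrite iY; nia.
  by have := tail i; lia.
(* Downward from [P + mu]; the alternative predecessor [P] is excluded modulo [n]. *)
have w_Pt i : P < i <= P + mu -> w i = i + T.
  have [e] := ubnP (P + mu - i); elim: e i => // e IHe i ie iP.
  have [->|imu] := eqVneq i (P + mu); first by lia.
  have wi1 : w i.+1 = i.+1 + T by apply: IHe; lia.
  have [|z wz [zP|[Pz zi]]] := pred_Pt i.+1; first by lia.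
    have vP' := vE' _ _ ltPM (erefl (w P)).
    have : n * b P + (i - P) = n.
      by move: wz; rewrite zP wi1; lia.
    have : 0 < i - P < n by lia.
    by move: bP_gt0; clear; nia.
  have zi' : z = i by lia.
  by rewrite -zi'; lia.
have wP_T : w P = P + T.
  have [|z wz [zP|]] := pred_Pt P.+1; first by lia.
    by rewrite zP in wz; have := w_Pt P.+1; lia.
  by lia.
have T_ge : n <= T by rewrite /T leq_pmulr.
have wY_E : w Y = Y - n by lia.
have YM : Y < M by [].
have bY1 : b Y = 1.
  have muY : P + mu < Y by lia.
  have vY : v Y = Y by have := v_end _ muY; have := leq_addl (n * a Y) Y; rewrite -/(v Y); lia.
  by have := vE _ YM; rewrite vY wY_E; move: bY; nia.
(* The ranks outside [[P, Y - n]] are already taken. *)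
have w_mid i : P + n <= i <= Y -> P <= w i <= Y - n.
  move=> iY; have iM : i < M by lia.
  rewrite w_geP //=; last by lia.
  rewrite leqNgt; apply/negP => wi.
  have [wiY|wiY] := ltnP Y (w i).
    by have := tail (w i); have := w_bd _ iM => wiM /(_ _)/w_inj; lia.
  have [wiP|wiP] := eqVneq (w i) (P + T).
    by have := w_inj i P iM ltPM; lia.
  have := w_Pt (w i - T); have := w_inj i (w i - T); lia.
have b_mid i : P + n <= i <= Y -> 0 < b i.
  move=> iY; have [->|neqiY] := eqVneq i Y; first by rewrite bY1.
  have w_i := w_mid _ iY.
  have wiY : w i != w Y by apply/eqP => /w_inj; lia.
  by rewrite -bY1 ord_noninv //; lia.
have w_shift i : P + n <= i <= Y -> w i + n = i.
  move=> iY.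
  (* Since [b > 0] here, [v = n * (b - 1) + (w + n)] has the shape required on the window
     [[P + n, Y]]. *)
  apply: (@fixed_prefix n (P + n) Y.+1 Y.+1 (fun i => w i + n) (fun i => (b i).-1) v) => //.
  - by move=> x xY; have := w_mid x; lia.
  - by move=> x y xY yY /addIn; apply: w_inj; lia.
  - move=> r rY; have [|x xM wx] := w_surj (r - n); first by lia.
    exists x; last by lia.
    have [xP|Px] := ltnP x P; first by have := wP _ xP; lia.
    have [xP|xP] := eqVneq x P; first by rewrite xP in wx; lia.
    have [xmu|mux] := leqP x (P + mu); first by have := w_Pt x; lia.
    have [xY|xY] := ltnP Y x; first by have := tail x; lia.
    by lia.
  - move=> x xY; have bx := b_mid x; have := vE x.
    have : n * b x = n * (b x).-1 + n by rewrite addnC -mulnS prednK //; apply: bx; lia.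
    by lia.
  - by move=> x y _ xy _; apply: v_gap.
  - move=> x y Px xy yY _ wyx.
    have : b x < b y by apply: ord_inv => //; lia.
    by have := b_mid x; lia.
  - by lia.
move=> i iM; rewrite /block_shift -/n -/T -YE.
have [|Pi] := ltnP i P; first exact: wP.
have [imu|mui] := leqP i (P + mu).
  by have [->//|iP] := eqVneq i P; apply: w_Pt; lia.
have [iY|Yi] := leqP i Y; first by have := w_shift i; lia.
by apply: tail; lia.
Qed.

(** * Divisibility by a linear polynomial *)

(** The divisor is [n] times [X - (- m / n)], so divisibility means vanishing at [- m / n]. *)
Lemma dvdp_linear (m n : nat) (c d : rat) : 0 < n ->
  ((n%:R *: 'X + m%:R%:P : {poly rat}) %| c *: 'X + d%:P)%R =
  (m%:R * c == n%:R * d)%R.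
Proof.
move=> n_gt0; have n_neq0 : (n%:R != 0 :> rat)%R by rewrite pnatr_eq0 -lt0n.
have -> : (n%:R *: 'X + m%:R%:P = n%:R *: ('X - (- m%:R / n%:R)%:P) :> {poly rat})%R.
  by rewrite scalerBr -[in RHS](mul_polyC _ _%:P) -polyCM mulrCA divff // mulr1 polyCN opprK.
rewrite dvdpZl // dvdp_XsubCl rootE hornerD hornerZ hornerX hornerC.
rewrite -subr_eq0 -[in RHS]subr_eq0.
have -> : (m%:R * c - n%:R * d = - n%:R * (c * (- m%:R / n%:R) + d - 0))%R by field.
by rewrite mulf_eq0 oppr_eq0 (negPf n_neq0).
Qed.

Lemma dvdp_linear_nat (m n r r' x y : nat) : 0 < n ->
  ((n%:R *: 'X + m%:R%:P : {poly rat}) %|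
     (r'%:R - r%:R) *: 'X + (x%:R - y%:R)%:P)%R =
  (m * r' + n * y == m * r + n * x).
Proof.
move=> n_gt0; rewrite dvdp_linear // -(eqr_nat rat) !natrD !natrM.
rewrite !mulrBr -subr_eq0 -[RHS]subr_eq0; congr (_ == _); ring.
Qed.

(** * Ranks as a bijection of positions *)

Definition precedes (b : seq nat) (i j : nat) : bool :=
  (nth 0 b j < nth 0 b i) || ((nth 0 b i == nth 0 b j) && (i < j)).

(* [rank_fun] minus 1, extended to [nat] so that ranks and positions can be
   computed with as numbers. *)
Definition pos {M : nat} (b : M.-tuple nat) (x : nat) : nat :=
  #|[set j : 'I_M | precedes b j x]|.

(** The two sets in [rank_fun] are disjoint, and the second contains [i] itself; without [i], their
    union is the set of predecessors. *)
Lemma rank_funE (M : nat) (b : M.-tuple nat) (i : 'I_M) :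
  rank_fun b i = (pos b i).+1.
Proof.
rewrite /rank_fun /pos; set A := [set j | _ < _]; set B := [set j | _ && _].
have iB : i \in B by rewrite inE leqnn eqxx.
rewrite [#|B|](cardsD1 i) iB addnCA add1n; congr _.+1.
have /eqP <- : #|A :|: (B :\ i)| == #|A| + #|B :\ i|.
  rewrite (leq_card_setU A (B :\ i)) -setI_eq0; apply/eqP/setP => j; rewrite !inE.
  by case: ltngtP; rewrite ?andbF.
apply: eq_card => j; rewrite !inE /precedes !(tnth_nth 0) -(inj_eq val_inj) /=.
by lia.
Qed.

Lemma pos_bound {M : nat} {b : M.-tuple nat} {i : nat} : i < M -> pos b i < M.
Proof.
move=> iM; rewrite -[X in _ < X]card_ord -cardsT; apply: proper_card.
apply/properP; split; first exact: subsetT.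
by exists (Ordinal iM); rewrite !inE // /precedes /= !ltnn andbF.
Qed.

Lemma pos_homo {M : nat} {b : M.-tuple nat} {i j : nat} :
  i < M -> precedes b i j -> pos b i < pos b j.
Proof.
move=> iM ij; apply: proper_card; apply/properP; split.
  by apply/subsetP => k; rewrite !inE; move: ij; rewrite /precedes; lia.
by exists (Ordinal iM); rewrite !inE // /precedes /= !ltnn andbF.
Qed.

Lemma precedes_total (b : seq nat) i j :
  [|| precedes b i j, i == j | precedes b j i].
Proof. by rewrite /precedes; lia. Qed.

Lemma pos_ltE {M : nat} {b : M.-tuple nat} {i j : nat} : i < M -> j < M ->
  (pos b i < pos b j) = precedes b i j.
Proof.
move=> iM jM; apply/idP/idP => [lt_ij|]; last exact: pos_homo.
have /or3P[//|/eqP ij|/(pos_homo jM)] := precedes_total b i j; last by lia.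
by rewrite ij ltnn in lt_ij.
Qed.

Lemma pos_inj {M : nat} {b : M.-tuple nat} {i j : nat} : i < M -> j < M ->
  pos b i = pos b j -> i = j.
Proof.
move=> iM jM eq_ij.
have /or3P[|/eqP//|] := precedes_total b i j; by rewrite -pos_ltE // eq_ij ltnn.
Qed.

Lemma inj_surj_lt (M : nat) (w : nat -> nat) :
  (forall i, i < M -> w i < M) ->
  (forall i j, i < M -> j < M -> w i = w j -> i = j) ->
  forall r, r < M -> exists2 i, i < M & w i = r.
Proof.
move=> w_bd w_inj r rM.
pose f (i : 'I_M) := Ordinal (w_bd i (ltn_ord i)).
have f_inj : injective f.
  by move=> i j /(congr1 val) /= /w_inj ij; apply/val_inj/ij.
have [g _ fK] := injF_bij f_inj.
by exists (g (Ordinal rM)); rewrite // -[RHS]/(val (Ordinal rM)) -{2}(fK (Ordinal rM)).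
Qed.

(** [w] permutes the positions, so [w i] counts the positions with smaller [w], and these are the
    predecessors of [i]. *)
Lemma pos_unique (M : nat) (b : M.-tuple nat) (w : nat -> nat) :
  (forall i, i < M -> w i < M) ->
  (forall i j, i < M -> j < M -> w i = w j -> i = j) ->
  (forall i j, i < M -> j < M -> w i < w j -> precedes b i j) ->
  forall i, i < M -> pos b i = w i.
Proof.
move=> w_bd w_inj w_ord i iM.
pose f (i : 'I_M) := Ordinal (w_bd i (ltn_ord i)).
have f_inj : injective f.
  by move=> x y /(congr1 val) /= /w_inj xy; apply/val_inj/xy.
have -> : pos b i = #|f @^-1: [set r : 'I_M | r < w i]|.
  apply: eq_card => j; rewrite !inE /=; apply/idP/idP; last exact: w_ord.
  move=> ji; rewrite ltnNge leq_eqVlt; apply/negP => /orP[/eqP/w_inj ij|].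
    by move: ji; rewrite (ij iM (ltn_ord j)) /precedes; lia.
  by move/(w_ord _ _ iM (ltn_ord j)); move: ji; rewrite /precedes; lia.
rewrite on_card_preimset; last exact: onW_bij (injF_bij f_inj).
by rewrite cardsE -sum1_card (big_ord_narrow (ltnW (w_bd _ iM))) sum1_card card_ord.
Qed.

(** * Weights, partial sums and rearrangements *)

Lemma weightE {M : nat} (b : M.-tuple nat) : weight b = \sum_(i < M) tnth b i.
Proof. by rewrite /weight sumnE big_tuple. Qed.

(** Before [c] partial sums compare termwise; from [c] on, the remaining tails compare the other way
    and the totals agree. *)
Lemma single_crossing {M : nat} (a b : M.-tuple nat) (c : nat) :
  (forall i, i < M -> i < c -> nth 0 b i <= nth 0 a i) ->
  (forall i, i < M -> c <= i -> nth 0 a i <= nth 0 b i) ->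
  weight a = weight b ->
  forall j : 'I_M,
    \sum_(i < M | i <= j) tnth b i <= \sum_(i < M | i <= j) tnth a i.
Proof.
move=> le_ba le_ab; rewrite !weightE => eq_ab j.
have [jc|cj] := ltnP j c.
  by apply: leq_sum => i ij; rewrite !(tnth_nth 0) le_ba //; lia.
move: eq_ab; rewrite (bigID (fun i : 'I_M => i <= j)) /=.
rewrite [RHS](bigID (fun i : 'I_M => i <= j)) /=.
suff : \sum_(i < M | ~~ (i <= j)) tnth a i <= \sum_(i < M | ~~ (i <= j)) tnth b i.
  by move=> tails sums; rewrite -(leq_add2r (\sum_(i < M | ~~ (i <= j)) tnth b i))
    -sums leq_add2l.
by apply: leq_sum => i ij; rewrite !(tnth_nth 0) le_ab //; lia.
Qed.

(** Ranks list the entries in nonincreasing order, and a sorted rearrangement is unique. *)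
Lemma rearr_pos {M : nat} (b g : M.-tuple nat) :
  (forall i, i < M -> nth 0 g (pos b i) = nth 0 b i) -> rearr b = g.
Proof.
move=> gE; apply: val_inj => /=.
have geq_trans : transitive geq by move=> y x z /= yx zy; apply: leq_trans zy yx.
have geq_anti : antisymmetric geq.
  by move=> x y /= xy; apply/eqP; rewrite eqn_leq andbC.
apply: (sorted_eq geq_trans geq_anti).
- by apply: sort_sorted => x y /=; apply: leq_total.
- apply/(sortedP 0) => r; rewrite size_tuple => rM.
  have surj := inj_surj_lt M (pos b) (@pos_bound _ b) (@pos_inj _ b).
  have [i iM wi] := surj r (ltnW rM).
  have [j jM wj] := surj r.+1 rM.
  rewrite /= -wj -wi !gE //.
  have : precedes b i j by rewrite -(pos_ltE iM jM) wi wj.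
  by rewrite /precedes; lia.
rewrite perm_sort; apply/tuple_permP.
have f_inj : injective (fun i : 'I_M => Ordinal (@pos_bound _ b _ (ltn_ord i))).
  by move=> x y /(congr1 val) /= /pos_inj xy; apply/val_inj/xy.
exists (perm f_inj); congr tval; apply: eq_from_tnth => i.
by rewrite tnth_mktuple permE !(tnth_nth 0) /= gE.
Qed.

(** Both families of ranks run over [0, ..., M - 1], so they cancel when the equations are
    summed. *)
Lemma weight_critical (m n M : nat) (a b : M.-tuple nat) : 0 < n ->
  (forall i, i < M -> m * pos b i + n * nth 0 b i = m * pos a i + n * nth 0 a i) ->
  weight a = weight b.
Proof.
move=> n_gt0 E.
have pos_sum (c : M.-tuple nat) : \sum_(i < M) pos c i = \sum_(i < M) i.
  have f_inj : injective (fun i : 'I_M => Ordinal (@pos_bound _ c _ (ltn_ord i))).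
    by move=> x y /(congr1 val) /= /pos_inj xy; apply/val_inj/xy.
  by rewrite [RHS](reindex_inj f_inj).
have : \sum_(i < M) (m * pos b i + n * nth 0 b i) =
       \sum_(i < M) (m * pos a i + n * nth 0 a i) by apply: eq_bigr => i _; apply: E.
rewrite !big_split -!big_distrr /= !pos_sum => /addnI/eqP.
rewrite eqn_mul2l eqn0Ngt n_gt0 /= => /eqP eq_ab.
by rewrite !weightE; under eq_bigr do rewrite (tnth_nth 0);
  under [RHS]eq_bigr do rewrite (tnth_nth 0).
Qed.

Lemma critical_pairE (m n M : nat) (a b : M.-tuple nat) :
  critical_pair m n a b <->
  [/\ 0 < m, 0 < n, coprime m n, tri_dom a b &
    forall i, i < M ->
      m * pos b i + n * nth 0 b i = m * pos a i + n * nth 0 a i].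
Proof.
split=> [] [m0 n0 mn dom E]; split=> // i.
  move=> iM; have := E (Ordinal iM); rewrite dvdp_linear_nat // !rank_funE.
  by rewrite !(tnth_nth 0) /= => /eqP; lia.
rewrite dvdp_linear_nat // !rank_funE !(tnth_nth 0); have := E _ (ltn_ord i).
by move=> Ei; apply/eqP; lia.
Qed.

Lemma tri_dom_irr {M : nat} (a : M.-tuple nat) : ~ tri_dom a a.
Proof. by case=> _ [[]|[_ []]]. Qed.

(** * The explicit critical partner *)

Definition notch (m P : nat) (a : nat -> nat) (i : nat) : nat :=
  m * a i - (i == P).

(** Solution of the rank equation for the ranks [block_shift]: moving down [mu + 1] ranks adds [m],
    and moving up [(mu + 1) * A] ranks subtracts [m * A]. *)
Definition notch_shift (mu m P A : nat) (a : nat -> nat) (i : nat) : nat :=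
  if i < P then m * a i
  else if i == P then m.-1
  else if i <= P + mu then 0
  else if i <= P + mu + mu.+1 * A then m * a i + m
  else 0.

Lemma notch_noninc {mu m P A : nat} {a : nat -> nat} i j :
  block_profile mu P A a -> i <= j -> notch m P a j <= notch m P a i.
Proof.
case=> mu_gt0 A_gt0 a_mono _ aP aPt _; rewrite leq_eqVlt => /predU1P[->//|ij].
rewrite /notch.
have ma : m * a j <= m * a i by rewrite leq_mul2l a_mono ?orbT // ltnW.
have [iP|iP] := eqVneq i P; last by lia.
have aj : a j <= A by rewrite -(aPt P.+1) ?a_mono; lia.
rewrite iP aP; have [->|m_gt0] := posnP m; first by rewrite !mul0n.
have : m * a j <= m * A by rewrite leq_mul2l aj orbT.
by rewrite mulnS; lia.
Qed.

Lemma block_shift_bound {mu P A M : nat} i :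
  P + mu + mu.+1 * A < M -> i < M -> block_shift mu P A i < M.
Proof. by rewrite /block_shift; repeat case: ifP => ?; lia. Qed.

Lemma block_shift_inj {mu P A : nat} : injective (block_shift mu P A).
Proof. by move=> i j; rewrite /block_shift; repeat case: ifP => ?; lia. Qed.

Lemma notch_shift_rank {mu m P A : nat} {a : nat -> nat} i :
  block_profile mu P A a -> 0 < m ->
  m * block_shift mu P A i + mu.+1 * notch_shift mu m P A a i =
  m * i + mu.+1 * notch m P a i.
Proof.
case=> mu_gt0 A_gt0 _ _ aP aPt a_end m_gt0; rewrite /block_shift /notch_shift /notch.
have [iP|Pi] := ltnP i P; first by rewrite (_ : i == P = false) ?subn0 //; lia.
have [->|iP] := eqVneq i P.
  by rewrite leq_addr aP; nia.
have [imu|mui] := leqP i (P + mu); first by rewrite aPt ?subn0; [nia | lia].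
have [iY|Yi] := leqP i (P + mu + mu.+1 * A); first by rewrite subn0 mulnBr; nia.
by case: (a_end _ mui) => [->|]; nia.
Qed.

(** In rank order the values are at least [m * (A + 1)], then between [m] and [m * (A + 1)], then
    [m - 1], then [0]. *)
Lemma notch_shift_order {mu m P A : nat} {a : nat -> nat} i j :
  block_profile mu P A a -> 0 < m -> block_shift mu P A i < block_shift mu P A j ->
  notch_shift mu m P A a j < notch_shift mu m P A a i \/
  (notch_shift mu m P A a j <= notch_shift mu m P A a i /\ i < j).
Proof.
case=> mu_gt0 A_gt0 a_mono _ aP aPt _ m_gt0.
have ma x y : x <= y -> m * a y <= m * a x by move=> xy; rewrite leq_mul2l a_mono ?orbT.
have ma_le x : x <= P -> m * A + m <= m * a x by move=> /ma; rewrite aP mulnS addnC.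
have ma_gt x : P < x -> m * a x <= m * A by move=> /ma; rewrite (aPt P.+1) //; lia.
have T_ge : mu.+1 <= mu.+1 * A by rewrite leq_pmulr.
have := ma i j; have := ma j i; have := ma_le i; have := ma_gt i.
have := ma_le j; have := ma_gt j.
by rewrite /block_shift /notch_shift; repeat case: ifP => ?; lia.
Qed.

(** Dominance comes from a single sign change, between the rearrangements if they differ and between
    the compositions otherwise. *)
Lemma critical_pair_shift {mu m P A M : nat} {a : nat -> nat} {al be : M.-tuple nat} :
  block_profile mu P A a -> 0 < m -> coprime m mu.+1 ->
  P + mu + mu.+1 * A < M ->
  (forall i, i < M -> nth 0 al i = notch m P a i) ->
  (forall i, i < M -> nth 0 be i = notch_shift mu m P A a i) ->
  critical_pair m mu.+1 al be.
Proof.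
move=> Ha m_gt0 m_cop ltM alE beE.
have pos_al i : i < M -> pos al i = i.
  apply: pos_unique => // x y xM yM xy.
  by rewrite /precedes !alE // ; have := notch_noninc (m := m) x y Ha; lia.
have pos_be i : i < M -> pos be i = block_shift mu P A i.
  apply: pos_unique => [x||x y xM yM]; first exact: block_shift_bound.
    by move=> x y _ _; apply: block_shift_inj.
  by move=> /(notch_shift_order _ _ Ha m_gt0); rewrite /precedes !beE //; lia.
have rankE i : i < M ->
    m * pos be i + mu.+1 * nth 0 be i = m * pos al i + mu.+1 * nth 0 al i.
  by move=> iM; rewrite pos_al // pos_be // alE // beE // notch_shift_rank.
have eq_w : weight al = weight be by apply: weight_critical rankE.
have rearr_al : rearr al = al by apply: rearr_pos => i iM; rewrite pos_al.
case: (Ha) => mu_gt0 A_gt0 a_mono a_gap aP aPt a_end.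
(* [gam] lists [notch_shift] in the order of [block_shift]. *)
pose gam i := if i < P then m * a i
  else if i < P + mu.+1 * A then m * a (i + mu.+1) + m
  else if i == P + mu.+1 * A then m.-1 else 0.
pose g := [tuple gam i | i < M].
have gE i : i < M -> nth 0 g i = gam i.
  by move=> iM; rewrite -[i]/(val (Ordinal iM)) -tnth_nth tnth_mktuple.
have rearr_be : rearr be = g.
  apply: rearr_pos => i iM; rewrite pos_be // gE ?block_shift_bound // beE //.
  rewrite /gam /block_shift /notch_shift.
  have [iP|Pi] := ltnP i P; first by rewrite iP.
  have [->|iP] := eqVneq i P.
    by rewrite leq_addr ltnNge leq_addr /= ltnn eqxx.
  have [imu|mui] := leqP i (P + mu); first by repeat case: ifP => ?; lia.
  have [iY|Yi] := leqP i (P + mu + mu.+1 * A); last by repeat case: ifP => ?; lia.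
  by rewrite subnK; repeat case: ifP => ?; lia.
have eq_wg : weight al = weight g.
  rewrite eq_w -rearr_be /weight; apply/perm_sumn.
  by rewrite /= perm_sym perm_sort.
have beyond0 i : P + mu + mu.+1 * A <= i -> a i = 0.
  by move=> iY; case: (a_end i) => //; nia.
(* This drop pays for the [m] added in [gam]. *)
have a_drop i : 0 < a i -> a (i + mu.+1) < a i.
  by case: (a_gap i (i + mu.+1)) => [|->|]; [exact: leq_addr | | nia].
have [L aL] : exists L, forall i, (i < L) = (0 < a i).
  have ex0 : exists i, a i == 0.
    by exists (P + mu + mu.+1 * A); rewrite beyond0.
  exists (ex_minn ex0) => i; case: ex_minnP => L /eqP aL minL.
  apply/idP/idP => [iL|ai]; first by rewrite lt0n; apply/negP => /minL; lia.
  by rewrite ltnNge; apply/negP => /a_mono; lia.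
have ma x y : x < y -> m * x + m <= m * y by move=> xy; rewrite addnC -mulnS leq_mul2l xy orbT.
have g_le i : i < L -> gam i <= notch m P a i.
  rewrite aL => ai; rewrite /gam /notch.
  have [iP|Pi] := ltnP i P; first by lia.
  have ma_i := ma _ _ (a_drop _ ai); have ma0 := ma _ _ ai.
  have [iP|iP] := eqVneq i P; last by repeat case: ifP => ?; lia.
  rewrite iP aP in ma_i ma0 *.
  (* At the notch a drop of one would not suffice; here [a] drops by at least two. *)
  have : a (P + mu.+1) < A by case: (a_end (P + mu.+1)) => [|->|]; nia.
  by move/ma; have := ma 0 A A_gt0; rewrite mulnS; repeat case: ifP => ?; lia.
have g_ge i : L <= i -> notch m P a i <= gam i.
  by rewrite leqNgt aL -eqn0Ngt /notch => /eqP ->; rewrite muln0.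
apply/critical_pairE; split=> //; split=> //; rewrite rearr_al rearr_be.
have [al_g|al_g] := eqVneq al g; [right; split=> //; split | left; split].
- move=> al_be; have PM : P.+1 < M by lia.
  have := alE _ PM; rewrite al_be beE // /notch_shift /notch aPt; last by lia.
  by repeat case: ifP => ?; nia.
- apply: (single_crossing _ _ (P + mu.+1)) => // i iM iP; rewrite alE // beE // /notch /notch_shift.
    have [->|_] := eqVneq i P; first by rewrite ltnn aP mulnS; lia.
    by repeat case: ifP => ?; lia.
  by repeat case: ifP => ?; try lia; rewrite beyond0; lia.
- by move/eqP: al_g.
apply: (single_crossing _ _ L) => // i iM; rewrite alE // gE //.
  exact: g_le.
exact: g_ge.
Qed.

(** * Uniqueness of the critical partner *)

(** Ranks determine the partner through the rank equation, so [rank_dichotomy] leaves two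
    candidates; irreflexivity of dominance excludes [al]. *)
Lemma critical_pair_unique {mu m P A M : nat} {a : nat -> nat} {al be be' : M.-tuple nat} :
  block_profile mu P A a -> P + mu + mu.+1 * A < M ->
  (forall i, i < M -> nth 0 al i = notch m P a i) ->
  (forall i, i < M -> nth 0 be i = notch_shift mu m P A a i) ->
  critical_pair m mu.+1 al be' -> be' = be.
Proof.
move=> Ha ltM alE beE /critical_pairE[m_gt0 _ m_cop dom rankE].
case: (Ha) => mu_gt0 A_gt0 a_mono a_gap aP aPt a_end.
have PM : P < M by lia.
have pos_al i : i < M -> pos al i = i.
  apply: pos_unique => // x y xM yM xy.
  by rewrite /precedes !alE // ; have := notch_noninc (m := m) x y Ha; lia.
have {}rankE i : i < M ->
    m * pos be' i + mu.+1 * nth 0 be' i = m * i + mu.+1 * notch m P a i.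
  by move=> iM; rewrite rankE // pos_al // alE.
have n_gt0 : 0 < mu.+1 by [].
have eq_be (c : M.-tuple nat) : (forall i, i < M ->
    m * pos be' i + mu.+1 * nth 0 c i = m * i + mu.+1 * notch m P a i) -> be' = c.
  move=> cE; apply: eq_from_tnth => i; rewrite !(tnth_nth 0).
  have := rankE _ (ltn_ord i); rewrite -(cE _ (ltn_ord i)) => /addnI/eqP.
  by rewrite eqn_mul2l => /eqP.
pose b i := (nth 0 be' i + (i == P)) %/ m.
have bE i : i < M -> nth 0 be' i + (i == P) = m * b i.
  move=> iM; rewrite mulnC divnK //.
  (* All terms but the first are multiples of [m], which is coprime to [mu + 1]. *)
  have E : mu.+1 * (nth 0 be' i + (i == P)) + m * pos be' i = m * (i + mu.+1 * a i).
    have := rankE _ iM; rewrite /notch.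
    have [->|iP] := eqVneq i P; last by nia.
    by rewrite aP; nia.
  rewrite -(Gauss_dvdr _ m_cop) -(dvdn_addl _ (dvdn_mulr (pos be' i) (dvdnn m))) E.
  exact: dvdn_mulr.
have wE i : i < M -> mu.+1 * a i + i = mu.+1 * b i + pos be' i.
  move=> iM; apply/eqP; rewrite -(eqn_pmul2l m_gt0) mulnDr [X in _ == X]mulnDr.
  rewrite !(mulnCA m) -bE //; have := rankE _ iM; rewrite /notch.
  have [->|iP] := eqVneq i P; last by move=> ?; apply/eqP; nia.
  by rewrite aP => ?; apply/eqP; nia.
have ord i j : i < M -> j < M -> pos be' i < pos be' j -> precedes be' i j.
  by move=> iM jM; rewrite pos_ltE.
have m_lt x y : m * x < m * y -> x < y by rewrite ltn_pmul2l.
have m_le x y : m * x <= m * y -> x <= y by rewrite leq_pmul2l.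
have bP : 0 < b P by have := bE _ PM; rewrite eqxx; case: (b P) => //; rewrite muln0; lia.
case: (rank_dichotomy mu P A M a (pos be') b Ha ltM) => //.
- by move=> i; apply: pos_bound.
- by move=> i j; apply: pos_inj.
- by apply: inj_surj_lt => [i|i j]; [apply: pos_bound | apply: pos_inj].
- move=> i j ij jM iP wji; have iM := ltn_trans ij jM.
  have := ord _ _ jM iM wji; have := bE _ iM; have := bE _ jM.
  by rewrite /precedes (negPf iP) => bj bi ?; apply: m_lt; lia.
- move=> j Pj jM wj; have := ord _ _ jM PM wj; have := bE _ PM; have := bE _ jM.
  by rewrite /precedes eqxx => bj bi ?; apply: m_le; lia.
- move=> i j ij jM jP wij; have iM := ltn_trans ij jM.
  have := ord _ _ iM jM wij; have := bE _ iM; have := bE _ jM.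
  by rewrite /precedes (negPf jP) => bj bi ?; apply: m_le; lia.
- move=> w_id; case: (@tri_dom_irr _ al); rewrite [X in tri_dom _ X](_ : al = be') //.
  by apply/esym/eq_be => i iM; rewrite w_id // alE.
move=> w_shift; apply: eq_be => i iM; rewrite w_shift // beE //.
exact: notch_shift_rank.
Qed.

(** * Block structure of [Lambda] *)

(** The offset [mu - rho] completes the first block to length [mu], so the quotient is the block
    number. *)
Definition Lambda_part (mu s l rho i : nat) : nat :=
  if i < rho + l * mu then s + l + 1 - (i + (mu - rho)) %/ mu else 0.

Lemma nth_flatten_nseq (mu c l : nat) (f : nat -> nat) (i : nat) : 0 < mu ->
  nth 0 (flatten [seq nseq mu (f j) | j <- iota c l]) i =
  if i < l * mu then f (c + i %/ mu) else 0.
Proof.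
move=> mu_gt0; elim: l c i => [|l IHl] c i; first by rewrite nth_nil.
rewrite /= nth_cat size_nseq nth_nseq IHl mulSn.
have [imu|mui] := ltnP i mu; first by rewrite divn_small // addn0 ltn_addr.
rewrite ltn_subLR //; case: ifP => // _; congr f.
by rewrite -[in RHS](subnK mui) divnDr // divnn mu_gt0 addSn addnA addn1.
Qed.

Lemma nth_Lambda (mu s l rho m i : nat) : 0 < mu -> rho <= mu ->
  nth 0 (Lambda mu s l rho m) i = m * Lambda_part mu s l rho i.
Proof.
move=> mu_gt0 rho_le; rewrite nth_cat size_nseq nth_nseq nth_flatten_nseq //.
rewrite /Lambda_part; have [irho|rhoi] := ltnP i rho.
  by rewrite ltn_addr // divn_small ?subn0 //; lia.
rewrite ltn_subLR //; case: ifP => _; last by rewrite muln0.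
have -> : i + (mu - rho) = i - rho + mu by lia.
by rewrite divnDr // divnn mu_gt0; congr (m * _); lia.
Qed.

Lemma nth_sub_eps_Lambda (mu s l rho m k i : nat) :
  0 < mu -> 0 < rho <= mu ->
  nth 0 (sub_eps (Lambda mu s l rho m) (rho + k * mu)) i =
  notch m (rho + k * mu).-1 (Lambda_part mu s l rho) i.
Proof.
move=> mu_gt0 /andP[rho_gt0 rho_le]; rewrite /notch -nth_Lambda //.
have [iL|Li] := ltnP i (size (Lambda mu s l rho m)).
  by rewrite nth_mkseq // -{1}(prednK (_ : 0 < rho + k * mu)) ?eqSS // ltn_addr.
by rewrite !nth_default // size_mkseq.
Qed.

(** For the block number [q], [mu * a + mu * q] is constant on the support. So [(mu + 1) * a i + i]
    is, up to a constant, [a i] plus the offset of [i] in its block; [a] decreases and offsets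
    differ by less than [mu], which gives the gap condition. *)
Lemma Lambda_profile (mu s l rho k : nat) :
  0 < mu -> 0 < rho <= mu -> k < l ->
  block_profile mu (rho + k * mu).-1 (s + l - k) (Lambda_part mu s l rho).
Proof.
move=> mu_gt0 rho_bd kl; rewrite /Lambda_part.
have k1l : k * mu + mu <= l * mu by rewrite addnC -mulSn leq_mul2r kl orbT.
pose q i := (i + (mu - rho)) %/ mu.
have q_le i j : i <= j -> q i <= q j by move=> ij; rewrite leq_div2r // leq_add2r.
have qE i : q i * mu <= i + (mu - rho) < q i * mu + mu.
  by rewrite /q leq_divM /= [X in _ < X]addnC -mulSn ltn_ceil.
have q_l i : i < rho + l * mu -> q i <= l.
  by move=> iL; rewrite -ltnS ltn_divLR // mulSn; lia.
have muq x : q x <= l -> mu * (s + l + 1 - q x) + q x * mu = mu * (s + l + 1).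
  by move=> xl; rewrite [q x * mu]mulnC -mulnDr subnK //; lia.
split=> //; first by lia.
- move=> i j ij; case: ifP => // jL; rewrite (leq_ltn_trans ij jL).
  by rewrite leq_sub2l // q_le.
- move=> i j ij; case: ifP => jL; [right | by left]; rewrite (leq_ltn_trans ij jL).
  rewrite -/(q i) -/(q j) !mulSn.
  have := q_l _ jL; have := q_le _ _ ij => qij qj.
  by have := muq i; have := muq j; have := qE i; have := qE j; lia.
- have -> : (rho + k * mu).-1 < rho + l * mu by lia.
  have -> : (rho + k * mu).-1 + (mu - rho) = k * mu + mu.-1 by lia.
  by rewrite divnMDl // divn_small; lia.
- move=> i iP; rewrite (_ : i < rho + l * mu); last by lia.
  have -> : i + (mu - rho) = k.+1 * mu + (i - (rho + k * mu)) by rewrite mulSn; lia.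
  by rewrite divnMDl // divn_small; lia.
move=> j jP; case: ifP => jL; [right | by left].
rewrite -/(q j) !mulSn.
have qk : k.+2 <= q j by rewrite leq_divRL // !mulSn; lia.
have qj := q_l _ jL.
have := muq j qj; have := qE j.
have : mu * (s + l + 1) = mu * (s + l - k) + k * mu + mu.
  by rewrite [k * mu]mulnC -mulnDr -mulnSr; congr (mu * _); lia.
by lia.
Qed.

(** * Length and weight bounds *)

Lemma len_eq (a : seq nat) (K : nat) :
  0 < nth 0 a K -> (forall i, K < i -> nth 0 a i = 0) -> len a = K.+1.
Proof.
move=> aK aK0; have Ka : K < size a.
  by rewrite ltnNge; apply/negP => /(nth_default 0) a0; rewrite a0 in aK.
apply/eqP; rewrite eqn_leq (leq_bigmax_cond (Ordinal Ka)) // andbT.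
apply/bigmax_leqP => i ai; rewrite ltnS leqNgt; apply/negP => /aK0 ai0.
by rewrite ai0 in ai.
Qed.

Lemma len_ge (a : seq nat) (K : nat) : 0 < nth 0 a K -> K < len a.
Proof.
move=> aK; have Ka : K < size a.
  by rewrite ltnNge; apply/negP => /(nth_default 0) a0; rewrite a0 in aK.
exact: (leq_bigmax_cond (Ordinal Ka)).
Qed.

Lemma weight_ge (a : seq nat) (p q c : nat) : p <= q ->
  (forall i, p <= i < q -> c <= nth 0 a i) -> (q - p) * c <= weight a.
Proof.
move=> pq ca; have [->//|c_gt0] := posnP c; first by rewrite muln0.
have [->|p_lt_q] := eqVneq p q; first by rewrite subnn.
(* As the default is [0], a positive bound keeps the window inside the sequence. *)
have qa : q <= size a.
  rewrite leqNgt; apply/negP => aq; have := ca q.-1.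
  by rewrite nth_default; lia.
rewrite /weight sumnE (big_nth 0) (big_cat_nat (n := q)) //=.
rewrite (big_cat_nat (n := p)) //= -sum_nat_const_nat.
apply: leq_trans (leq_addr _ _); apply: leq_trans (leq_addl _ _).
by rewrite big_nat [X in _ <= X]big_nat; apply: leq_sum.
Qed.

Lemma nth_pad (M : nat) (a : seq nat) (i : nat) : i < M ->
  nth 0 (pad M a) i = nth 0 a i.
Proof.
by move=> iM; rewrite -[i in LHS]/(val (Ordinal iM)) -tnth_nth tnth_mktuple.
Qed.

(** * Application to [lambda^(k)] *)

Theorem theorem4 (mu s l rho m k : nat)
  (hmu : 1 <= mu) (hl : 1 <= l) (hm : 1 <= m)
  (hrho1 : 1 <= rho) (hrho2 : rho <= mu)
  (hcop : coprime m (mu + 1)) (hk : k <= l - 1) :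
  let lambda_k := sub_eps (Lambda mu s l rho m) (rho + k * mu) in
  let N := (s + l + 1) * mu + s + rho in
  let M := len lambda_k + weight lambda_k in
  exists beta : M.-tuple nat,
    unique (fun b : M.-tuple nat =>
              critical_pair m (mu + 1) (pad M lambda_k) b) beta
    /\ len beta = N + l - k
    /\ N < len beta.
Proof.
move=> lambda_k N M.
have kl : k < l by lia.
have rho_bd : 0 < rho <= mu by rewrite hrho1.
have Ha := Lambda_profile mu s l rho k hmu rho_bd kl.
set P := (rho + k * mu).-1 in Ha; set A := s + l - k in Ha.
set a := Lambda_part mu s l rho in Ha.
have lamE i : nth 0 lambda_k i = notch m P a i by apply: nth_sub_eps_Lambda.
case: (Ha) => _ A_gt0 a_mono _ aP aPt a_end.
have lam_ge i : P <= i <= P + mu -> A <= nth 0 lambda_k i.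
  move=> iP; rewrite lamE /notch; have mA : A <= m * A by rewrite leq_pmull.
  have [->|Pi] := eqVneq i P; first by rewrite aP mulnS; lia.
  by rewrite aPt ?subn0 //; lia.
(* The length exceeds [P + mu], and the [mu + 1] entries from [P] to [P + mu] are at least [A]. *)
have ltM : P + mu + mu.+1 * A < M.
  have lenP : P + mu < len lambda_k by apply/len_ge/(leq_trans A_gt0)/lam_ge; lia.
  have : mu.+1 * A <= weight lambda_k.
    rewrite -[mu.+1](addKn P); apply: weight_ge; first exact: leq_addr.
    by move=> i iP; apply: lam_ge; lia.
  by rewrite /M; lia.
(* The left side is the 1-based position of the last nonzero entry of the partner. *)
have KE : (P + mu + mu.+1 * A).+1 = N + l - k.
  rewrite /N /A /P.
  have : (s + l + 1) * mu = mu * (s + l - k) + k * mu + mu.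
    by rewrite mulnC [k * mu]mulnC -mulnDr -mulnSr; congr (mu * _); lia.
  by rewrite !mulSn; lia.
pose be := [tuple notch_shift mu m P A a i | i < M].
have beE i : i < M -> nth 0 be i = notch_shift mu m P A a i.
  by move=> iM; rewrite -[i in LHS]/(val (Ordinal iM)) -tnth_nth tnth_mktuple.
have alE i : i < M -> nth 0 (pad M lambda_k) i = notch m P a i.
  by move=> iM; rewrite nth_pad.
have len_be : len be = N + l - k.
  rewrite -KE; apply: len_eq => [|i Yi].
    by rewrite beE // /notch_shift; repeat case: ifP => ?; lia.
  have [iM|Mi] := ltnP i M; last by rewrite nth_default // size_tuple.
  by rewrite beE // /notch_shift; repeat case: ifP => ?; lia.
rewrite addn1 in hcop *; exists be; split; last by rewrite len_be; lia.
split; first exact: critical_pair_shift Ha hm hcop ltM alE beE.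
by move=> b /(critical_pair_unique Ha ltM alE beE).
Qed.
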